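(* Let $y:[t_0,\infty)\to\mathbb R$ be the (continuous) plant output, let $\bar y$ be the transmitted output generated by the plant-side triggering law with threshold $\gamma_y>0$, and let $\{t_j\}_{j\in\mathbb N}$ be the instants generated by the controller-side triggering law with thresholds $\gamma_{\bar y}>\gamma_y$ and $\gamma_\xi,\gamma_\zeta,\gamma_h,\gamma_f>0$ (both laws are given in the context). Then $$|y(t)-\bar y(t_j)|\le\tilde\gamma_y\qquad\text{for all } t\in[t_j,t_{j+1}),\ j\in\mathbb N,$$ where $\tilde\gamma_y=\gamma_y+\gamma_{\bar y}$.
   Context: $\mathbb N$ is the set of nonnegative integers. Both triggering sequences start at the initial time $t_0$, and the infimum of the empty set is $+\infty$. - Plant-side triggering law: $\bar t_{k+1}=\inf\{t>\bar t_k:|y(t)-y(\bar t_k)|\ge\gamma_y\}$, $k\in\mathbb N$. - Transmitted output (zero-order hold): $\bar y(t)=y(\bar t_k)$ for $t\in[\bar t_k,\bar t_{k+1})$. The number $\bar y(t_j)$ is the value of $\bar y$ at time $t=t_j$. - Controller-side triggering law: $t_{j+1}$ is the infimum of the times $t>t_j$ at which at least one of the following holds: $|\bar y(t)-\bar y(t_j)|\ge\gamma_{\bar y}$; $\|\xi(t)-\xi(t_j)\|\ge\gamma_\xi$; $\|\zeta(t)-\zeta(t_j)\|\ge\gamma_\zeta$; $|\hat\theta(t)-\hat\theta(t_j)|\ge\gamma_h$; $\|\alpha_f(t)-\alpha_f(t_j)\|\ge\gamma_f$. Here $\xi(t),\zeta(t)\in\mathbb R^n$ (observer states), $\hat\theta(t)\in\mathbb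 R$ (parameter estimate) and $\alpha_f(t)\in\mathbb R^{n-1}$ (filter states) are the controller's internal states, which are continuous functions of time, and $\|\cdot\|$ is the 2-norm. *)

(* Defs.v *)
From HB Require Import structures.
From mathcomp Require Import all_boot all_order all_algebra.
From mathcomp Require Import all_classical all_reals all_analysis.
Import Order.TTheory GRing.Theory Num.Theory.
Import numFieldNormedType.Exports.

Set Implicit Arguments.
Unset Strict Implicit.
Unset Printing Implicit Defensive.

Local Open Scope classical_set_scope.
Local Open Scope ring_scope.

(* The norm that the library puts on matrices is the sup norm. *)
Definition norm2 (R : realType) (n : nat) (v : 'cV[R]_n) : R :=
  Num.sqrt (\sum_(i < n) v i 0 ^+ 2).

(* inf {t > s | E t}, equal to +oo when no such t exists; in particular it is
   +oo when s = +oo, so that a triggering sequence which stops is continued by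
   the constant +oo. *)
Definition next_trigger (R : realType) (E : R -> Prop) (s : \bar R) : \bar R :=
  ereal_inf [set t%:E | t in [set t : R | (s < t%:E)%E /\ E t]].

(* The value of [fine] at +oo is irrelevant below: at an instant equal to +oo,
   no real t satisfies the constraint s < t, resp. s <= t, under which it is used. *)

Definition plant_triggering (R : realType) (t0 gamma_y : R) (y : R -> R)
    (tbar : nat -> \bar R) : Prop :=
  tbar 0%N = t0%:E /\
  forall k : nat, tbar k.+1 =
    next_trigger (fun t => `|y t - y (fine (tbar k))| >= gamma_y) (tbar k).

Definition zero_order_hold (R : realType) (y : R -> R) (tbar : nat -> \bar R)
    (ybar : R -> R) : Prop :=
  forall (k : nat) (t : R), (tbar k <= t%:E < tbar k.+1)%E ->
    ybar t = y (fine (tbar k)).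

Definition controller_triggering (R : realType) (n : nat)
    (t0 gamma_ybar gamma_xi gamma_zeta gamma_h gamma_f : R)
    (ybar : R -> R) (xi zeta : R -> 'cV[R]_n) (thetahat : R -> R)
    (alphaf : R -> 'cV[R]_n.-1) (tc : nat -> \bar R) : Prop :=
  tc 0%N = t0%:E /\
  forall j : nat, tc j.+1 =
    next_trigger (fun t =>
      `|ybar t - ybar (fine (tc j))| >= gamma_ybar \/
      norm2 (xi t - xi (fine (tc j))) >= gamma_xi \/
      norm2 (zeta t - zeta (fine (tc j))) >= gamma_zeta \/
      `|thetahat t - thetahat (fine (tc j))| >= gamma_h \/
      norm2 (alphaf t - alphaf (fine (tc j))) >= gamma_f) (tc j).

(* Main.v *)
(* The error splits as |y(t) - ybar(t)| + |ybar(t) - ybar(t_j)|, and each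
   summand is below its threshold as long as the corresponding law has not fired
   again. For the first one, t has to lie in some interval
   [tbar_k, tbar_(k+1)), that is, the plant-side instants must not accumulate:
   y jumps by at least gamma_y between consecutive finite instants, which is
   impossible along a convergent sequence of instants since y is continuous. *)

Require Import Defs.
From HB Require Import structures.
From mathcomp Require Import all_boot all_order all_algebra.
From mathcomp Require Import all_classical all_reals all_analysis.
Import Order.TTheory GRing.Theory Num.Theory.
Import numFieldNormedType.Exports.

Local Open Scope classical_set_scope.
Local Open Scope ring_scope.

Lemma next_trigger_ge (R : realType) (E : R -> Prop) (s : \bar R) :
  (s <= next_trigger E s)%E.
Proof. by apply: le_ereal_inf_tmp => _ [t [/ltW st _] <-]. Qed.

Lemma next_trigger_lt (R : realType) (E : R -> Prop) (s : \bar R) (t : R) :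
  (s < t%:E < next_trigger E s)%E -> ~ E t.
Proof.
move=> /andP[st]; rewrite ltNge => /negP tE Et; apply: tE.
by apply: ereal_inf_lbound; exists t.
Qed.

Lemma next_trigger_dist_lt (R : realType) (y : R -> R) (g : R) (s t : R) :
  0 < g ->
  (s%:E <= t%:E < next_trigger (fun u => g <= `|y u - y s|)%R s%:E)%E ->
  `|y t - y s| < g.
Proof.
(* The law tests only times after [s], so [t = s] is treated apart: there the difference is 0 and
   [0 < g] decides. *)
move=> g0 /andP[]; rewrite lee_fin le_eqVlt => /predU1P[-> _|st tE].
  by rewrite subrr normr0.
have /next_trigger_lt/negP : (s%:E < t%:E <
    next_trigger (fun u => g <= `|y u - y s|)%R s%:E)%E by rewrite lte_fin st.
by rewrite -ltNge.
Qed.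

Lemma within_continuous_dist (R : realType) (A : set R) (f : R -> R) (x e : R) :
  {within A, continuous f} -> A x -> 0 < e ->
  exists2 d : R, 0 < d &
    forall z, A z -> `|z - x| < d -> `|f z - f x| < e.
Proof.
move=> /subspace_continuousP fc Ax e0.
have /cvgrPdist_lt/(_ _ e0) := fc _ Ax.
move=> [d /= d0 dP]; exists d => // z Az zx.
by rewrite distrC; apply: dP => //=; rewrite distrC.
Qed.

(** A finite infimum is attained: by continuity, a jump smaller than [g] at [u] would stay smaller
    than [g] slightly to the right of [u], where triggering times must exist. *)
Lemma next_trigger_dist_ge (R : realType) (y : R -> R) (t0 g s u : R) :
  {within `[t0, +oo[, continuous y} -> t0 <= s ->
  next_trigger (fun v => g <= `|y v - y s|) s%:E = u%:E ->
  g <= `|y u - y s|.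
Proof.
move=> yc t0s uE; rewrite leNgt; apply/negP => ug.
have su : s <= u by rewrite -lee_fin -uE next_trigger_ge.
have t0u : t0 <= u := le_trans t0s su.
(* The tolerance is the slack left below [g] at [u], so that the triangle inequality through [y u]
   keeps the jump below [g] on [[u, u + d)]. *)
have [||d d0 dP] := @within_continuous_dist _ _ _ u (g - `|y u - y s|) yc.
- by rewrite /= in_itv /= t0u.
- by rewrite subr_gt0.
have : (next_trigger (fun v => g <= `|y v - y s|)%R s%:E < (u + d)%:E)%E.
  by rewrite uE lte_fin ltrDl.
move=> /ereal_inf_lt[_ [v [sv gv] <-]]; rewrite lte_fin => vud.
have uv : u <= v by rewrite -lee_fin -uE; apply: ereal_inf_lbound; exists v.
have : `|y v - y u| < g - `|y u - y s|.
  apply: dP; first by rewrite /= in_itv /= (le_trans t0u uv).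
  by rewrite ger0_norm ?subr_ge0// ltrBlDl.
rewrite ltrBrDr ltNge => /negP; apply; apply: le_trans gv _.
exact: ler_distD.
Qed.

Lemma plant_triggering_no_accumulation (R : realType) (t0 g : R) (y : R -> R)
    (tbar : nat -> \bar R) (t : R) :
  0 < g -> {within `[t0, +oo[, continuous y} ->
  plant_triggering t0 g y tbar -> exists k, (t%:E < tbar k)%E.
Proof.
move=> g0 yc [tbar0 tbarS]; apply: contrapT => /forallNP tbar_le.
have {}tbar_le k : (tbar k <= t%:E)%E by rewrite leNgt; apply/negP/tbar_le.
have tbarSle k : (tbar k <= tbar k.+1)%E by rewrite tbarS next_trigger_ge.
have tbar_ge k : (t0%:E <= tbar k)%E.
  by elim: k => [|k IHk]; [rewrite tbar0|exact: le_trans IHk _].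
pose a k := fine (tbar k).
(* Under the assumption to be refuted, every instant lies between [t0] and [t], hence is real and
   [fine] loses nothing. *)
have aE k : tbar k = (a k)%:E.
  by rewrite fineK// fin_numElt (lt_le_trans (ltNyr t0))//
    (le_lt_trans (tbar_le k))// ltry.
have a_ge k : t0 <= a k by rewrite -lee_fin -aE.
have a_cvg : a @ \oo --> sup (range a).
  apply: nondecreasing_cvgn.
    by apply/nondecreasing_seqP => k; rewrite -lee_fin -!aE.
  by exists t => _ [k _ <-]; rewrite -lee_fin -aE.
set l := sup (range a) in a_cvg.
have t0l : t0 <= l.
  apply: le_trans (a_ge 0%N) _; apply: ub_le_sup; last by exists 0%N.
  by exists t => _ [k _ <-]; rewrite -lee_fin -aE.
(* With tolerance [g / 2] around [y l], two consecutive late samples differ by less than [g]. *)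
have [||d d0 dP] := @within_continuous_dist _ _ _ l (g / 2) yc.
- by rewrite /= in_itv /= t0l.
- by rewrite divr_gt0.
have /cvgrPdist_lt/(_ _ d0)[N _ NP] := a_cvg.
have ya k : (N <= k)%N -> `|y (a k) - y l| < g / 2.
  move=> Nk; apply: dP; first by rewrite /= in_itv /= a_ge.
  by rewrite distrC; apply: NP.
have : g <= `|y (a N.+1) - y (a N)|.
  by apply: next_trigger_dist_ge yc (a_ge N) _; rewrite -!aE tbarS.
apply/negP; rewrite -ltNge; apply: le_lt_trans (ler_distD (y l) _ _) _.
by rewrite (splitr g) (distrC (y l)) ltrD// ya.
Qed.

Lemma zero_order_hold_dist_lt (R : realType) (t0 g : R) (y ybar : R -> R)
    (tbar : nat -> \bar R) (t : R) :
  0 < g -> {within `[t0, +oo[, continuous y} ->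
  plant_triggering t0 g y tbar -> zero_order_hold y tbar ybar ->
  t0 <= t -> `|y t - ybar t| < g.
Proof.
move=> g0 yc tbar_law hold t0t.
have [tbar0 tbarS] := tbar_law.
have ex_gt := plant_triggering_no_accumulation R t0 g y tbar t g0 yc tbar_law.
(* The least index whose instant exceeds [t] is not 0, since [tbar 0 = t0 <= t]; its predecessor [k]
   gives the hold interval containing [t]. *)
have [k tk kmin] := ex_minnP ex_gt.
case: k tk kmin => [|k] tk kmin.
  by move: tk; rewrite tbar0 lte_fin ltNge t0t.
have kt : (tbar k <= t%:E)%E.
  by rewrite leNgt; apply/negP => /kmin; rewrite ltnn.
have tbar_ge i : (t0%:E <= tbar i)%E.
  elim: i => [|i IHi]; first by rewrite tbar0.
  by rewrite tbarS (le_trans IHi)// next_trigger_ge.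
have kE : tbar k = (fine (tbar k))%:E.
  by rewrite fineK// fin_numElt (lt_le_trans (ltNyr t0))//
    (le_lt_trans kt)// ltry.
rewrite (hold k) ?kt//; apply: next_trigger_dist_lt => //.
by rewrite -kE -tbarS kt.
Qed.

Theorem mainTheorem2 (R : realType) (n : nat) (n_gt0 : (0 < n)%N)
    (t0 gamma_y gamma_ybar gamma_xi gamma_zeta gamma_h gamma_f : R)
    (y ybar : R -> R) (xi zeta : R -> 'cV[R]_n) (thetahat : R -> R)
    (alphaf : R -> 'cV[R]_n.-1) (tbar tc : nat -> \bar R)
    (gamma_y_gt0 : 0 < gamma_y) (gamma_ybar_gt : gamma_y < gamma_ybar)
    (gamma_xi_gt0 : 0 < gamma_xi) (gamma_zeta_gt0 : 0 < gamma_zeta)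
    (gamma_h_gt0 : 0 < gamma_h) (gamma_f_gt0 : 0 < gamma_f)
    (y_cont : {within `[t0, +oo[, continuous y})
    (xi_cont : {within `[t0, +oo[, continuous xi})
    (zeta_cont : {within `[t0, +oo[, continuous zeta})
    (thetahat_cont : {within `[t0, +oo[, continuous thetahat})
    (alphaf_cont : {within `[t0, +oo[, continuous alphaf})
    (tbar_law : plant_triggering t0 gamma_y y tbar)
    (ybar_hold : zero_order_hold y tbar ybar)
    (tc_law : controller_triggering t0 gamma_ybar gamma_xi gamma_zeta gamma_h
                gamma_f ybar xi zeta thetahat alphaf tc) :
  forall (j : nat) (t : R), (tc j <= t%:E < tc j.+1)%E ->
    `|y t - ybar (fine (tc j))| <= gamma_y + gamma_ybar.
Proof.
move=> j t /andP[jt tj1]; have [tc0 tcS] := tc_law.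
have tc_ge i : (t0%:E <= tc i)%E.
  elim: i => [|i IHi]; first by rewrite tc0.
  by rewrite tcS (le_trans IHi)// next_trigger_ge.
have t0t : t0 <= t by rewrite -lee_fin (le_trans (tc_ge j)).
apply: le_trans (ler_distD (ybar t) _ _) _; apply: lerD.
  by apply/ltW; apply: zero_order_hold_dist_lt tbar_law ybar_hold t0t.
(* At [t = tc j] the law says nothing, but the difference vanishes. *)
move: jt; rewrite le_eqVlt => /predU1P[->|jt].
  by rewrite /= subrr normr0 (ltW (lt_trans gamma_y_gt0 gamma_ybar_gt)).
(* A larger difference would satisfy the [ybar] clause, the first disjunct of the law, strictly
   between [tc j] and [tc j.+1]. *)
rewrite leNgt; apply/negP => /ltW t_trig.
by move: tj1; rewrite tcS => tj1; apply: (@next_trigger_lt _ _ (tc j) t);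
  [rewrite jt; exact: tj1|left].
Qed.
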